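(* Let $G$ be a non-bipartite regular graph with $v$ vertices, valency $k$ and odd girth $g$. If every edge of $G$ is contained in the same number of cycles of length $g$, then $$\alpha(G) \leq \frac{v}{2}\left(1-\frac{1}{g}\right).$$
   Context: All graphs are finite, simple and undirected. The odd girth of a non-bipartite graph is the length of a shortest odd cycle. $\alpha(G)$ denotes the independence number of $G$, i.e. the maximum size of a set of pairwise non-adjacent vertices. ''Cycles of length $g$'' are counted as subgraphs of $G$. *)

(* Defs.v *)
From mathcomp Require Import all_boot.

Set Implicit Arguments.
Unset Strict Implicit.
Unset Printing Implicit Defensive.

Record sgraph := SGraph {
  vertex :> finType;
  adj : rel vertex;
  adj_sym : symmetric adj;
  adj_irr : irreflexive adj
}.

Section Graphs.
Variable G : sgraph.

Definition bipartite : Prop :=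
  exists A : {set G}, forall x y : G, adj x y -> (x \in A) != (y \in A).

Definition regular (k : nat) : Prop :=
  forall x : G, #|[set y | adj x y]| = k.

Definition independent (S : {set G}) : bool :=
  [forall x in S, forall y in S, ~~ adj x y].

Definition alpha : nat := \max_(S : {set G} | independent S) #|S|.

(* Without the bound on the size, an edge would give a cycle [:: x; y]. *)
Definition is_cycle (c : seq G) : bool :=
  [&& 2 < size c, uniq c & cycle (@adj G) c].

Definition cycle_edges (c : seq G) : {set {set G}} :=
  [set [set x; next c x] | x in c].

(* A cycle as a subgraph is represented by its edge set, so that the 2n vertex
   sequences differing by rotation or reversal are counted only once. *)
Definition cycles (n : nat) : {set {set {set G}}} :=
  [set cycle_edges c | c : n.-tuple G & is_cycle c].

Definition cycles_through (n : nat) (x y : G) : {set {set {set G}}} :=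
  [set C in cycles n | [set x; y] \in C].

Definition is_odd_girth (g : nat) : Prop :=
  [/\ odd g,
      exists c : seq G, is_cycle c /\ size c = g
    & forall c : seq G, is_cycle c -> odd (size c) -> g <= size c].

Definition edges_in_equally_many_cycles (n : nat) : Prop :=
  exists m : nat, forall x y : G, adj x y -> #|cycles_through n x y| = m.

End Graphs.

(* Main.v *)
Require Import Defs.
From mathcomp Require Import all_boot all_order all_algebra.
From mathcomp Require Import zify ring.

(** Fix an independent set [S].  Along a cycle of odd length [g], the successor
    of a vertex of [S] lies outside [S], so [S] contains at most half of the [g]
    vertices, hence at most [(g - 1) / 2] of them by parity.

    Averaging over all cycles of length [g] turns this into a bound on [S].  Each
    cycle through a vertex [x] uses exactly two of the edges at [x]
    ([card_cycle_edges_at]).  Since every edge lies on [m] such cycles and every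
    vertex on [k] edges, the numbers of edges used at [x], added up over all
    cycles, give [k * m] for every vertex [x] ([cycle_degree_sum]).  If [N] is the
    number of cycles, summing over the vertices of [S] gives
    [#|S| * (k * m) <= N * (g - 1)], and summing over all vertices gives
    [v * (k * m) = N * (2 * g)].  Eliminating [N] leaves
    [2 * g * #|S| * (k * m) <= v * (g - 1) * (k * m)], and [k * m] can be
    cancelled: it is positive because some cycle of length [g] exists. *)

Set Implicit Arguments.
Unset Strict Implicit.
Unset Printing Implicit Defensive.
Import Order.TTheory GRing.Theory Num.Theory.

Lemma set2_inj (T : finType) (x y z t : T) :
  z != t -> [set x; y] = [set z; t] -> x = z /\ y = t \/ x = t /\ y = z.
Proof.
move=> nzt E.
have: z \in [set x; y] by rewrite E set21.
have: t \in [set x; y] by rewrite E set22.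
by rewrite !inE => /orP[]/eqP Et /orP[]/eqP Ez; auto; rewrite Et Ez eqxx in nzt.
Qed.

Lemma next_neq_prev (T : eqType) (c : seq T) (x : T) :
  2 < size c -> uniq c -> x \in c -> next c x != prev c x.
Proof.
move=> c_gt2 Uc xc; apply/eqP=> E.
have: next c (next c x) = x by rewrite E next_prev.
have [i c' Ec] := rot_to xc.
rewrite -!(next_rot i Uc) Ec.
have: uniq (x :: c') by rewrite -Ec rot_uniq.
have: 2 < size (x :: c') by rewrite -Ec size_rot.
case: c' {Ec} => [|y [|z c']] //= _.
rewrite !inE !negb_or eqxx -!andbA => /and4P[nxy nxz _ _].
rewrite eq_sym (negPf nxy) eqxx => Ezx.
by rewrite Ezx eqxx in nxz.
Qed.

Section IndependentSets.
Variable G : sgraph.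
Implicit Types (c : seq G) (S : {set G}) (x y : G).

Lemma mem_cycle_edges c x y :
  is_cycle c ->
  ([set x; y] \in cycle_edges c) = (x \in c) && (y \in [set next c x; prev c x]).
Proof.
case/and3P=> _ Uc Cc; apply/imsetP/andP => [[z zc]|[xc]].
  have nz : z != next c z.
    by apply: contraTneq (next_cycle Cc zc) => <-; rewrite adj_irr.
  case/(set2_inj nz) => -[-> ->]; rewrite ?mem_next zc !inE ?eqxx //.
  by rewrite prev_next // eqxx orbT.
rewrite !inE => /orP[]/eqP->; first by exists x.
by exists (prev c x); rewrite ?mem_prev // next_prev // setUC.
Qed.

(** The two edges of a cycle at one of its vertices lead to its successor and to
    its predecessor, which differ because a cycle has more than two vertices. *)
Lemma card_cycle_edges_at c x :
  is_cycle c -> #|[set y | [set x; y] \in cycle_edges c]| = (x \in c) * 2.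
Proof.
move=> Hc; have [c_gt2 Uc _] := and3P Hc.
case xc: (x \in c).
  have -> : [set y | [set x; y] \in cycle_edges c] = [set next c x; prev c x].
    by apply/setP=> y; rewrite inE mem_cycle_edges // xc.
  by rewrite cards2 next_neq_prev.
by apply: eq_card0 => y; rewrite inE mem_cycle_edges // xc.
Qed.

Lemma sum_cycle_edges_at c S :
  is_cycle c ->
  \sum_(x in S) #|[set y | [set x; y] \in cycle_edges c]|
    = 2 * #|[set x in c | x \in S]|.
Proof.
move=> Hc; rewrite (eq_bigr _ (fun x _ => card_cycle_edges_at x Hc)).
rewrite -big_distrl /= mulnC -big_mkcondr sum1dep_card; congr (2 * _).
by apply: eq_card => x; rewrite !inE andbC.
Qed.

(** Passing to the successor injects the vertices of [S] on the cycle into those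
    outside [S]. *)
Lemma independent_on_cycle c S :
  is_cycle c -> independent S -> 2 * #|[set x in c | x \in S]| <= size c.
Proof.
case/and3P=> _ Uc Cc indS; set A := [set x in c | x \in S].
have <- : #|[set x in c]| = size c by rewrite cardsE (card_uniqP Uc).
have inj : injective (next c) := can_inj (prev_next Uc).
rewrite mul2n -addnn -{2}(card_imset A inj) -leq_subRL; last first.
  by apply/subset_leq_card/subsetP=> x; rewrite !inE => /andP[].
have sA : A \subset [set x in c] by apply/subsetP=> x; rewrite !inE => /andP[].
rewrite -(setIidPr sA) setIC (setIidPl sA) -cardsDS //.
apply/subset_leq_card/subsetP => _ /imsetP[x + ->].
rewrite !inE mem_next => /andP[xc xS]; rewrite xc /= andbT.
apply/negP=> nS.
move: indS => /forall_inP /(_ _ xS) /forall_inP /(_ _ nS).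
by rewrite (next_cycle Cc xc).
Qed.

Lemma cyclesP n (C : {set {set G}}) :
  reflect (exists c, [/\ is_cycle c, size c = n & C = cycle_edges c])
          (C \in cycles G n).
Proof.
apply: (iffP imsetP) => [[c Hc ->]|[c [Hc sc ->]]].
  by rewrite inE in Hc; exists c; rewrite size_tuple; split.
have sc' : size c == n by apply/eqP.
by exists (Tuple sc'); rewrite ?inE.
Qed.

Lemma cycle_edges_adj n (C : {set {set G}}) x y :
  C \in cycles G n -> [set x; y] \in C -> adj x y.
Proof.
case/cyclesP=> c [Hc _ ->]; have [_ _ Cc] := and3P Hc.
rewrite mem_cycle_edges // !inE => /andP[xc /orP[]/eqP->].
  exact: next_cycle.
by rewrite adj_sym prev_cycle.
Qed.

(** Double counting of the pairs of a cycle of length [n] and one of its edges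
    at [x]. *)
Lemma cycle_degree_sum n k m x :
  regular G k -> (forall y, adj x y -> #|cycles_through n x y| = m) ->
  \sum_(C in cycles G n) #|[set y | [set x; y] \in C]| = k * m.
Proof.
move=> hreg hm.
under eq_bigr => C HC.
  rewrite -sum1dep_card (eq_bigl (fun y => adj x y && ([set x; y] \in C))).
    over.
  move=> y /=; case xy: ([set x; y] \in C); last by rewrite andbF.
  by rewrite (cycle_edges_adj HC xy).
rewrite /= (exchange_big_dep (adj x)) /=; last by move=> C y _ /andP[].
rewrite -(hreg x) -sum1dep_card big_distrl /=; apply: eq_bigr => y xy.
rewrite mul1n -(hm y xy) -sum1_card; apply: eq_bigl => C.
by rewrite inE xy.
Qed.

Lemma independent_card_cycles S n k m :
  odd n -> independent S -> regular G k ->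
  (forall x y : G, adj x y -> #|cycles_through n x y| = m) ->
  #|S| * (k * m) <= #|cycles G n| * n.-1.
Proof.
move=> n_odd indS hreg hm; rewrite -!sum_nat_const.
rewrite -(eq_bigr _ (fun x _ => cycle_degree_sum hreg (hm x))) exchange_big /=.
apply: leq_sum => C /cyclesP[c [Hc sc ->]].
rewrite sum_cycle_edges_at //.
have := independent_on_cycle Hc indS; rewrite sc.
lia.
Qed.

Lemma card_cycles n k m :
  regular G k -> (forall x y : G, adj x y -> #|cycles_through n x y| = m) ->
  #|G| * (k * m) = #|cycles G n| * (2 * n).
Proof.
move=> hreg hm; rewrite -cardsT -!sum_nat_const.
rewrite -(eq_bigr _ (fun x _ => cycle_degree_sum hreg (hm x))) exchange_big /=.
apply: eq_bigr => C /cyclesP[c [Hc sc ->]].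
rewrite sum_cycle_edges_at // -sc; congr (2 * _).
have [_ Uc _] := and3P Hc; rewrite -(card_uniqP Uc).
by apply: eq_card => x; rewrite !inE andbT.
Qed.

Lemma degree_cycles_gt0 n k m c :
  is_cycle c -> size c = n -> regular G k ->
  (forall x y : G, adj x y -> #|cycles_through n x y| = m) -> 0 < k * m.
Proof.
move=> Hc sc hreg hm; have [c_gt2 _ Cc] := and3P Hc.
have [x xc] : exists x, x \in c.
  by case: (c) c_gt2 => // x c' _; exists x; rewrite mem_head.
have xy := next_cycle Cc xc.
rewrite muln_gt0 -(hreg x) -(hm _ _ xy); apply/andP; split.
  by apply/card_gt0P; exists (next c x); rewrite inE.
apply/card_gt0P; exists (cycle_edges c); rewrite inE mem_cycle_edges // xc.
by rewrite set21 !andbT; apply/cyclesP; exists c.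
Qed.

Lemma alpha_bound g k :
  is_odd_girth G g -> regular G k -> edges_in_equally_many_cycles G g ->
  2 * g * alpha G <= #|G| * g.-1.
Proof.
case=> g_odd [c [Hc sc]] _ hreg [m hm].
have km_gt0 := degree_cycles_gt0 Hc sc hreg hm.
have g2_gt0 : 0 < 2 * g by rewrite -sc; case/and3P: Hc; case: (c).
rewrite mulnC -leq_divRL //; apply/bigop.bigmax_leqP => S indS.
rewrite leq_divRL // -(leq_pmul2r km_gt0) [leqRHS]mulnAC (card_cycles hreg hm).
have := independent_card_cycles g_odd indS hreg hm; nia.
Qed.

End IndependentSets.

Local Open Scope ring_scope.

Theorem corollary2p2 (G : sgraph) (v k g : nat)
    (hbip : ~ bipartite G) (hv : #|G| = v) (hreg : regular G k)
    (hg : is_odd_girth G g) (hcyc : edges_in_equally_many_cycles G g) :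
  (alpha G)%:R <= v%:R / 2%:R * (1 - 1 / g%:R) :> rat.
Proof.
have := alpha_bound hg hreg hcyc; rewrite hv.
have g_gt0 : (0 < g)%N by case: hg => + _ _; case: (g).
have gR : 0 < g%:R :> rat by rewrite ltr0n.
rewrite -(ler_nat rat) !natrM -subn1 natrB // => B.
have -> : v%:R / 2%:R * (1 - 1 / g%:R)
          = v%:R * (g%:R - 1) / (2%:R * g%:R) :> rat.
  by field; rewrite gt_eqF.
by rewrite ler_pdivlMr ?mulr_gt0 // mulrC.
Qed.
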